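(* Let $m\geq n\geq 1$ be integers, let $X,Y\in M_{m\times n}(\mathbb{C})$ with $X\neq 0$, and let $\lambda,\mu\in\mathbb{C}$ be distinct. If $m=n$ and either $Y=\lambda X$ or $Y=\mu X$, assume that $\operatorname{rank} X<m$. (a) There is a normal $A\in M_{m}(\mathbb{C})$ such that the spectrum of $A$ is contained in $\{\lambda,\mu\}$ and $AX=Y$ if and only if $(Y-\lambda X)^*(Y-\mu X)=0$. (b) If $X$, $Y$, $\lambda$, and $\mu$ are real and $(Y-\lambda X)^{\mathsf{T}}(Y-\mu X)=0$, then there is a real normal $A\in M_{m}(\mathbb{R})$ such that the spectrum of $A$ is contained in $\{\lambda,\mu\}$ and $AX=Y$.
   Context: $M_{m\times n}(\mathbb{F})$ is the set of $m\times n$ matrices over $\mathbb{F}=\mathbb{R}$ or $\mathbb{C}$, and $M_m(\mathbb{F})=M_{m\times m}(\mathbb{F})$. $Z^*$ denotes the conjugate transpose and $Z^{\mathsf{T}}$ the transpose of $Z$. $A$ is normal if $A^*A=AA^*$. The spectrum of $A$ is its set of (complex) eigenvalues. *)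

(* Defs.v *)
From mathcomp Require Export all_boot all_order all_algebra.
From mathcomp Require Export spectral sesquilinear.
From mathcomp Require Export reals.
From mathcomp.real_closed Require Export complex.

(* For a realType R, R[i] is the field of complex numbers. [M ^t*] is the
   conjugate transpose and [realmx] means that all entries are real.
   [eigenvalue A a] is defined by a nonzero row vector v with
   v *m A = a *: v; for a square matrix over a field these are the same
   scalars as those with a nonzero column eigenvector. *)

(* Main.v *)
Require Import Defs.
Set Implicit Arguments.
Unset Strict Implicit.
Unset Printing Implicit Defensive.
Import Order.TTheory GRing.Theory Num.Theory.
Local Open Scope ring_scope.
Local Open Scope complex_scope.
Local Open Scope sesquilinear_scope.

(** Put U = Y - lambda X and V = Y - mu X, so that U - V = (mu - lambda) X.
    If A is normal with spectrum in {lambda, mu}, unitary diagonalization gives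
    (A - lambda)^* (A - mu) = 0, hence U^* V = X^* (A - lambda)^* (A - mu) X = 0.
    Conversely, if U^* V = 0 and Q is the orthogonal projection onto the column
    space of U, then Q U = U and Q V = 0, and A = lambda (1 - Q) + mu Q works.
    As Q = U (U^* U)^+ U^*, it is real whenever U is. *)

Section NumClosed.
Variable C : numClosedFieldType.

Lemma trmxC_mul m n p (A : 'M[C]_(m, n)) (B : 'M_(n, p)) :
  (A *m B)^t* = B^t* *m A^t*.
Proof. by rewrite trmx_mul map_mxM. Qed.

(** Each diagonal entry of the Gram matrix is the sum of the squared moduli of a column of [A]. *)
Lemma gram_eq0 m n (A : 'M[C]_(m, n)) : A^t* *m A = 0 -> A = 0.
Proof.
move=> /matrixP AA0; apply/matrixP=> i j; rewrite mxE.
have /eqP := AA0 j j; rewrite !mxE.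
under eq_bigr => k _ do rewrite !mxE -normCKC.
rewrite psumr_eq0 => [/allP /(_ i (mem_index_enum _))|k _]; last exact: exprn_ge0.
by rewrite expf_eq0 normr_eq0 => /eqP.
Qed.

(** If [K] is the cokernel of the Gram matrix, then [A *m K] has zero Gram matrix, so it vanishes.
    This inclusion of row spaces is what lets [pinvmx] cancel in [colprojK]. *)
Lemma sub_gram m n (A : 'M[C]_(m, n)) : (A <= A^t* *m A)%MS.
Proof.
rewrite submxE; apply/eqP/gram_eq0.
by rewrite trmxC_mul -mulmxA (mulmxA _ A) mulmx_coker mulmx0.
Qed.

Definition colproj m n (A : 'M[C]_(m, n)) : 'M_m :=
  A *m pinvmx (A^t* *m A) *m A^t*.

Section ColProj.
Variables (m n : nat) (A : 'M[C]_(m, n)).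

Lemma colprojK : colproj A *m A = A.
Proof. by rewrite /colproj -mulmxA mulmxKpV ?sub_gram. Qed.

Lemma colproj_adjK : A^t* *m (colproj A)^t* = A^t*.
Proof. by rewrite -trmxC_mul colprojK. Qed.

(** No symmetry of [pinvmx] is assumed: the projection equals its product with its own adjoint,
    which is visibly Hermitian. *)
Lemma colproj_herm : (colproj A)^t* = colproj A.
Proof.
have QQ : colproj A *m (colproj A)^t* = colproj A.
  by rewrite {1}/colproj -mulmxA colproj_adjK.
by rewrite -{1}QQ trmxC_mul trmxCK QQ.
Qed.

Lemma colproj_idem : colproj A *m colproj A = colproj A.
Proof. by rewrite {2}/colproj mulmxA (mulmxA _ A) colprojK. Qed.

Lemma colproj_ortho p (V : 'M_(m, p)) :
  A^t* *m V = 0 -> colproj A *m V = 0.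
Proof. by move=> AV0; rewrite /colproj -mulmxA AV0 mulmx0. Qed.

(** Pseudo-inversion commutes with field morphisms; hence a real [A] has a real projection. *)
Lemma colproj_conj : map_mx Num.conj (colproj A) = colproj (map_mx Num.conj A).
Proof. by rewrite /colproj 2!map_mxM map_pinvmx map_mxM !map_trmx. Qed.

End ColProj.

Lemma conj_realmx m n (A : 'M[C]_(m, n)) : map_mx Num.conj A = A -> A \is a realmx.
Proof.
by move=> /matrixP AE; apply/mxOverP => i j; rewrite CrealE -[X in _ == X]AE mxE.
Qed.

Lemma two_eigenvalue_normal m (A : 'M[C]_m) (a b : C) :
  A \is normalmx -> (forall c, eigenvalue A c -> c = a \/ c = b) ->
  (A - a%:M)^t* *m (A - b%:M) = 0.
Proof.
move=> /orthomx_spectralP; have := spectral_unitarymx A.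
set P := spectralmx A; set d := spectral_diag A => Pu AE Aab.
have PP : P *m P^t* = 1%:M by apply/unitarymxP.
have PA : P *m A = diag_mx d *m P.
  by rewrite {1}AE !mulmxA mulmxV ?unitarymx_unit ?mul1mx.
have shift c : P *m (A - c%:M) = (diag_mx d - c%:M) *m P.
  by rewrite mulmxBr mulmxBl PA scalar_mxC.
(* Row [i] of [P] is a left eigenvector for [d 0 i]; it is nonzero since [P *m P^t*] has diagonal
   entries 1. *)
have dab i : d 0 i = a \/ d 0 i = b.
  apply: Aab; apply/eigenvalueP; exists (row i P).
    by rewrite -row_mul PA row_mul row_diag_mx -scalemxAl -rowE.
  apply: contraTneq (oner_neq0 C) => Pi0.
  have /rowP /(_ i) : row i P *m P^t* = row i 1%:M by rewrite -row_mul PP.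
  by rewrite Pi0 mul0mx !mxE eqxx => /esym/eqP ->.
(* At each diagonal position one of the two factors is zero. *)
have D0 : (diag_mx d - a%:M)^t* *m (diag_mx d - b%:M) = 0.
  rewrite -!diag_const_mx -!linearB /= tr_diag_mx map_diag_mx mulmx_diag.
  rewrite -[RHS](linear0 (@diag_mx C m)); congr diag_mx; apply/rowP=> i.
  by rewrite !mxE; case: (dab i) => ->; rewrite subrr ?mulr0 ?rmorph0 ?mul0r.
have PtP : P^t* *m P = 1%:M by apply: mulmx1C.
rewrite -[A - b%:M in LHS]mul1mx -PtP -!mulmxA shift !mulmxA -trmxC_mul shift.
by rewrite trmxC_mul -(mulmxA (P^t*)) D0 mulmx0 mul0mx.
Qed.

Definition two_eigenvalue_mx m (Q : 'M[C]_m) (a b : C) : 'M_m :=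
  a%:M + (b - a) *: Q.

Section TwoEigenvalueMx.
Variables (m : nat) (Q : 'M[C]_m) (a b : C).

Lemma two_eigenvalue_mx_normal :
  Q^t* = Q -> two_eigenvalue_mx Q a b \is normalmx.
Proof.
move=> QE; apply/normalmxP.
rewrite /two_eigenvalue_mx linearD /= linearZ /= tr_scalar_mx map_mxD map_mxZ QE.
rewrite map_scalar_mx !mulmxDl !mulmxDr -!scalemxAl -!scalemxAr.
rewrite -!scalar_mxM mulrC -!scalar_mxC !scalerA (mulrC (b - a)).
by rewrite -!addrA; congr (_ + _); rewrite addrCA.
Qed.

(** An eigenvector [v] satisfies [(b - a) vQ = (c - a) v]. Multiplying by the idempotent [Q] gives
    [(c - b) vQ = 0], whence [(c - b)(c - a) v = 0]. *)
Lemma two_eigenvalue_mx_spectrum c : Q *m Q = Q ->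
  eigenvalue (two_eigenvalue_mx Q a b) c -> c = a \/ c = b.
Proof.
move=> QQ /eigenvalueP[v]; rewrite mulmxDr scalar_mxC mul_scalar_mx -scalemxAr.
move=> vA v0.
have vQ : (b - a) *: (v *m Q) = (c - a) *: v.
  by rewrite [RHS]scalerBl -vA [RHS]addrAC subrr add0r.
have vQc : (c - b) *: (v *m Q) = 0.
  have := congr1 (mulmx^~ Q) vQ; rewrite -!scalemxAl -mulmxA QQ => /eqP.
  by rewrite -subr_eq0 -scalerBl opprB addrA subrK -opprB scaleNr oppr_eq0 => /eqP.
have : (c - b) * (c - a) == 0.
  have : ((c - b) * (c - a)) *: v == 0.
    by rewrite -scalerA -vQ scalerA mulrC -scalerA vQc scaler0.
  by rewrite scaler_eq0 (negPf v0) orbF.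
by rewrite mulf_eq0 !subr_eq0 => /orP[]/eqP; [right|left].
Qed.

Lemma two_eigenvalue_mx_real : a \is Num.real -> b \is Num.real ->
  map_mx Num.conj Q = Q -> two_eigenvalue_mx Q a b \is a realmx.
Proof.
move=> /CrealP aR /CrealP bR QE; apply: conj_realmx.
by rewrite map_mxD map_mxZ map_scalar_mx rmorphB /= aR bR QE.
Qed.

(** Since [(b - a) X] is the difference of the two residuals, [Q] maps it to [Y - a X], exactly what
    must be added to [a X]. *)
Lemma two_eigenvalue_mx_interp n (X Y : 'M_(m, n)) :
  Q *m (Y - a *: X) = Y - a *: X -> Q *m (Y - b *: X) = 0 ->
  two_eigenvalue_mx Q a b *m X = Y.
Proof.
move=> QU QV; rewrite mulmxDl mul_scalar_mx -scalemxAl scalemxAr.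
have -> : (b - a) *: X = (Y - a *: X) - (Y - b *: X).
  by rewrite scalerBl opprB addrCA addrAC subrr add0r addrC.
by rewrite mulmxBr QU QV subr0 addrC subrK.
Qed.

End TwoEigenvalueMx.

End NumClosed.

Theorem theorem10p1 (R : realType) (m n : nat) (X Y : 'M[R[i]]_(m, n))
    (lambda mu : R[i])
    (n_ge1 : (1 <= n)%N) (m_ge_n : (n <= m)%N)
    (X_neq0 : X != 0) (lambda_neq_mu : lambda != mu)
    (rankX : m = n -> Y = lambda *: X \/ Y = mu *: X -> (\rank X < m)%N) :
  ((exists A : 'M[R[i]]_m,
      [/\ A \is normalmx,
          (forall a : R[i], eigenvalue A a -> a = lambda \/ a = mu) &
          A *m X = Y])
   <-> (Y - lambda *: X) ^t* *m (Y - mu *: X) = 0)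
  /\
  (X \is a realmx -> Y \is a realmx ->
   lambda \is Num.real -> mu \is Num.real ->
   (Y - lambda *: X)^T *m (Y - mu *: X) = 0 ->
   exists A : 'M[R[i]]_m,
     [/\ A \is a realmx,
         A \is normalmx,
         (forall a : R[i], eigenvalue A a -> a = lambda \/ a = mu) &
         A *m X = Y]).
Proof.
(* The witness is kept explicit so that the real case can reuse it and add only that it is real. *)
have interp : (Y - lambda *: X)^t* *m (Y - mu *: X) = 0 ->
    let Q := colproj (Y - lambda *: X) in
    let A := two_eigenvalue_mx Q lambda mu in
    [/\ A \is normalmx, (forall a, eigenvalue A a -> a = lambda \/ a = mu) &
        A *m X = Y].
  move=> UV0 Q A; split.
  - exact/two_eigenvalue_mx_normal/colproj_herm.
  - by move=> a; apply/two_eigenvalue_mx_spectrum/colproj_idem.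
  - apply: two_eigenvalue_mx_interp; first exact: colprojK.
    exact: colproj_ortho.
split; first split.
- move=> [A [An Asp <-]].
  by rewrite -!mul_scalar_mx -!mulmxBl trmxC_mul -mulmxA (mulmxA _ _ X)
    two_eigenvalue_normal // mul0mx mulmx0.
- by move=> UV0; eexists; apply: interp.
move=> XR YR lR mR UV0.
have UR : map_mx Num.conj (Y - lambda *: X) = Y - lambda *: X.
  by rewrite map_mxB map_mxZ /= (CrealP lR) !realmxC.
(* For a real matrix the transpose in the hypothesis is the conjugate transpose. *)
have [|An Asp AX] := interp; first by rewrite -map_trmx UR.
eexists; split; [|exact: An|exact: Asp|exact: AX].
by apply: two_eigenvalue_mx_real => //; rewrite colproj_conj UR.
Qed.
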